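(* For every $\eta>0$ there exists a constant $C_\eta$ such that for all $0<\delta<\frac12$, all measurable $E\subset[0,1]^2$ and all $\lambda>0$, the set $$F=\Bigl\{(x,t)\in\mathbb{R}^2\times[1,2] : \frac{|C^\delta(x,t)\cap E|}{|C^\delta(x,t)|}>\lambda\Bigr\}$$ satisfies $$\lambda\,|F|^{\frac16}\le C_\eta\,\delta^{-\eta}\,|E|^{\frac12}.$$
   Context: $C^\delta(x,t)=\{z\in\mathbb{R}^2: ||z-x|-t|<\delta\}$ is the $\delta$-neighborhood of the circle of center $x\in\mathbb{R}^2$ and radius $t$. $|F|$ is three-dimensional Lebesgue measure; $|E|$ and $|C^\delta(x,t)|$ are two-dimensional Lebesgue measure. *)

(* Defs.v *)
From HB Require Import structures.
From mathcomp Require Import all_boot all_order all_algebra.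
From mathcomp Require Import all_classical all_reals all_analysis.
Set Implicit Arguments.
Unset Strict Implicit.
Unset Printing Implicit Defensive.
Import Order.TTheory GRing.Theory Num.Theory.
Import numFieldNormedType.Exports.
Local Open Scope classical_set_scope.
Local Open Scope ring_scope.

Section LebesguePlaneSpace.
Variable R : realType.

Local Notation mu := (@lebesgue_measure R).
Local Notation mu2 := (mu \x mu)%E.
Local Notation mu3 := (mu \x mu \x mu)%E.

(* The product measures of the library are only meaningful on the product
   Borel sigma-algebra; completing them gives Lebesgue measure on R^2 and R^3
   (as total functions, the Lebesgue outer measures). *)
Definition lebesgue2 : set (R * R) -> \bar R :=
  @completed_measure_extension _ _ _ mu2.

Definition lebesgue3 : set (R * R * R) -> \bar R :=
  @completed_measure_extension _ _ _ mu3.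

(* Lebesgue (not merely Borel) measurability in the plane. *)
Definition lebesgue_measurable2 : set (set (R * R)) :=
  (mu2^*)%mu.-cara.-measurable.

(* The library norm on R * R is the sup norm. *)
Definition enorm2 (z : R * R) : R := Num.sqrt (z.1 ^+ 2 + z.2 ^+ 2).

Definition annulus (delta : R) (x : R * R) (t : R) : set (R * R) :=
  [set z | `|enorm2 (z - x) - t| < delta].

(* The ratio is taken in \bar R; for 0 < delta and 1 <= t the denominator is
   positive and finite, so it is the usual quotient. *)
Definition richset (delta lambda : R) (E : set (R * R)) : set (R * R * R) :=
  [set p | 1 <= p.2 <= 2 /\
    (lambda%:E < lebesgue2 (annulus delta p.1 p.2 `&` E)
                 / lebesgue2 (annulus delta p.1 p.2))%E].

End LebesguePlaneSpace.

(* Main.v *)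
Require Import Defs.
From HB Require Import structures.
From mathcomp Require Import all_boot all_order all_algebra.
From mathcomp Require Import ring lra.
From mathcomp Require Import all_classical all_reals all_analysis.
From mathcomp Require Import measurable_realfun.

(** No loss in delta is needed. Replace E by a Borel hull G and count incidences
    between rich circles and triples of points of G that are pairwise
    r-separated, r being a small multiple of lambda. An r-square meets an annulus
    in measure O(r delta), so every rich circle carries a set of such triples of
    measure at least (lambda delta)^3. Conversely the circles passing
    delta-close to three r-separated points have measure O((delta / r)^3): the
    radius is determined up to 2 delta by the centre, and each pair of points
    confines the centre to a strip, because |x - z|^2 - |x - z'|^2 is affine in
    x. Tonelli gives lambda^6 |F| <= C |E|^3. *)

Set Implicit Arguments.
Unset Strict Implicit.
Unset Printing Implicit Defensive.
Import Order.TTheory GRing.Theory Num.Theory.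
Import numFieldNormedType.Exports.
Local Open Scope classical_set_scope.
Local Open Scope ring_scope.

(** * Sigma-finiteness of product measures *)

Section ProductSigmaFinite.
Context d1 d2 (T1 : measurableType d1) (T2 : measurableType d2) (R : realType).
Variables (m1 : {sigma_finite_measure set T1 -> \bar R})
  (m2 : {sigma_finite_measure set T2 -> \bar R}).

Lemma product_measure1_sigma_finite : sigma_finite setT (m1 \x m2)%E.
Proof.
have [F TF Ffin] := sigma_finiteT m1; have [G TG Gfin] := sigma_finiteT m2.
(* The rectangles [F i] times [G j] are enumerated through the countable encoding of pairs; a number
   encoding no pair merely repeats the rectangle of index (0, 0). *)
pose ij n : nat * nat := odflt (0, 0)%N (unpickle n).
exists (fun n => F (ij n).1 `*` G (ij n).2).
  apply/seteqP; split=> // -[x y] _.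
  have [i _ Fx] : (\bigcup_i F i) x by rewrite -TF.
  have [j _ Gy] : (\bigcup_j G j) y by rewrite -TG.
  by exists (pickle (i, j)) => //; rewrite /ij pickleK.
move=> n; have [mF Foo] := Ffin (ij n).1; have [mG Goo] := Gfin (ij n).2.
split; first exact: measurableX.
by rewrite product_measure1E// lte_mul_pinfty// ge0_fin_numE.
Qed.

(* The library attaches a sigma-finite structure to [m1 \x m2] only for
   probability measures; this alias carries it in general. *)
Definition sf_product := (m1 \x m2)%E.

HB.instance Definition _ := Measure.on sf_product.

HB.instance Definition _ := @Measure_isSigmaFinite.Build _ _ _ sf_product
  product_measure1_sigma_finite.

End ProductSigmaFinite.

(** * Bounds for product measures by slices *)

Section ProductMeasureBounds.
Context d1 d2 (T1 : measurableType d1) (T2 : measurableType d2) (R : realType).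
Variables (m1 : {measure set T1 -> \bar R})
  (m2 : {sigma_finite_measure set T2 -> \bar R}).
Local Open Scope ereal_scope.

Lemma le_product_measure1 (S : set (T1 * T2)) (B : set T1) (c : R) :
  measurable S -> measurable B -> (0 <= c)%R ->
  (forall x, B x -> c%:E <= m2 (xsection S x)) -> c%:E * m1 B <= (m1 \x m2) S.
Proof.
move=> mS mB c0 cS; rewrite -integral_cst//.
have mX := measurable_fun_xsection m2 mS.
apply: (@le_trans _ _ (\int[m1]_(x in B) (m2 \o xsection S) x)).
  apply: ge0_le_integral => //; exact: measurable_funTS.
by apply: ge0_subset_integral => //; exact: measurable_funTS.
Qed.

Lemma product_measure1_le (S : set (T1 * T2)) (B : set T1) (c : R) :
  measurable S -> measurable B -> (0 <= c)%R -> (forall z, S z -> B z.1) ->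
  (forall x, B x -> m2 (xsection S x) <= c%:E) -> (m1 \x m2) S <= c%:E * m1 B.
Proof.
move=> mS mB c0 SB cS; rewrite -integral_cst//.
have mX := measurable_fun_xsection m2 mS.
rewrite /product_measure1 [leRHS]integral_mkcond/=.
apply: ge0_le_integral => //.
- exact/(measurable_restrictT _ _).1.
- move=> x _; rewrite patchE; case: ifPn => [|/negP xB]; first by rewrite inE; exact: cS.
  suff -> : xsection S x = set0 by rewrite measure0.
  by apply/seteqP; split=> y //; rewrite /xsection/= inE => /SB/= Bx; apply: xB; rewrite inE.
Qed.


End ProductMeasureBounds.

Lemma product_measure1_le2 d1 d2 (T1 : measurableType d1) (T2 : measurableType d2)
  (R : realType) (m1 : {sigma_finite_measure set T1 -> \bar R})
  (m2 : {sigma_finite_measure set T2 -> \bar R}) (S : set (T1 * T2)) (B : set T2) (c : R) :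
  measurable S -> measurable B -> 0 <= c -> (forall z, S z -> B z.2) ->
  (forall y, B y -> (m1 (ysection S y) <= c%:E)%E) ->
  ((m1 \x m2) S <= c%:E * m2 B)%E.
Proof.
move=> mS mB c0 SB cS; rewrite -integral_cst//.
(* Tonelli: by uniqueness of the product measure, the order of integration may be exchanged. *)
have -> : (m1 \x m2)%E S = (m1 \x^ m2)%E S.
  by apply: product_measure_unique => //= *; rewrite product_measure2E.
have mY := measurable_fun_ysection m1 mS.
rewrite /product_measure2 [leRHS]integral_mkcond/=.
apply: ge0_le_integral => //.
- exact/(measurable_restrictT _ _).1.
- move=> x _; rewrite patchE; case: ifPn => [|/negP xB]; first by rewrite inE; exact: cS.
  suff -> : ysection S x = set0 by rewrite measure0.
  by apply/seteqP; split=> y //; rewrite /ysection/= inE => /SB/= Bx; apply: xB; rewrite inE.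
Qed.

(** * Planar sets with short projection and short slices *)

Section PlanarSets.
Variable R : realType.
Local Notation mu := (@lebesgue_measure R).
Local Notation mu2 := (mu \x mu)%E.

Lemma lebesgue_measure_itv_le (a L : R) : 0 <= L ->
  (mu `[(a - L)%R, (a + L)%R] <= (2 * L)%:E)%E.
Proof.
move=> L0; rewrite lebesgue_measure_itv/= lte_fin.
by case: ifPn => _; rewrite -?EFinB lee_fin; lra.
Qed.

(** The interval of radius [L] about any point of [S] contains [S]; centring at a point of the set
    is what costs the factor 2, here and in the planar versions. *)
Lemma lebesgue_measure_diam_le (S : set R) (L : R) : measurable S -> 0 <= L ->
  (forall a b, S a -> S b -> `|a - b| <= L) -> (mu S <= (2 * L)%:E)%E.
Proof.
move=> mS L0 dS; have [->|/set0P[a Sa]] := eqVneq S set0.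
  by rewrite measure0 lee_fin; lra.
have : S `<=` `[a - L, a + L].
  by move=> b Sb /=; rewrite in_itv/=; have := dS _ _ Sa Sb; rewrite ler_norml; lra.
move=> /(le_measure mu); rewrite !inE => /(_ mS (measurable_itv _))/le_trans; apply.
exact: lebesgue_measure_itv_le.
Qed.

Lemma lebesgue2_diam_le (S : set (R * R)) (L1 L2 : R) : measurable S ->
  0 <= L1 -> 0 <= L2 ->
  (forall p q, S p -> S q -> `|p.1 - q.1| <= L1) ->
  (forall p q, S p -> S q -> p.1 = q.1 -> `|p.2 - q.2| <= L2) ->
  (mu2 S <= (2 * L2 * (2 * L1))%:E)%E.
Proof.
move=> mS L10 L20 d1 d2; have [->|/set0P[p Sp]] := eqVneq S set0.
  by rewrite measure0 lee_fin; nra.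
have := @product_measure1_le _ _ _ _ _ mu mu S `[p.1 - L1, p.1 + L1] (2 * L2) mS.
move=> /(_ (measurable_itv _)) H; apply: le_trans (H _ _ _) _; first by lra.
- by move=> z Sz; rewrite /= in_itv/=; have := d1 _ _ Sp Sz; rewrite ler_norml; lra.
- move=> x _; apply: lebesgue_measure_diam_le => //; first exact: measurable_xsection.
  by move=> a b; rewrite /xsection/= !inE => Sa Sb; exact: (d2 _ _ Sa Sb).
- rewrite [leRHS]EFinM; apply: lee_pmul => //; first by rewrite lee_fin; lra.
  exact: lebesgue_measure_itv_le.
Qed.

Lemma lebesgue2_diam_le2 (S : set (R * R)) (L1 L2 : R) : measurable S ->
  0 <= L1 -> 0 <= L2 ->
  (forall p q, S p -> S q -> `|p.2 - q.2| <= L1) ->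
  (forall p q, S p -> S q -> p.2 = q.2 -> `|p.1 - q.1| <= L2) ->
  (mu2 S <= (2 * L2 * (2 * L1))%:E)%E.
Proof.
move=> mS L10 L20 d1 d2; have [->|/set0P[p Sp]] := eqVneq S set0.
  by rewrite measure0 lee_fin; nra.
have := @product_measure1_le2 _ _ _ _ _ mu mu S `[p.2 - L1, p.2 + L1] (2 * L2) mS.
move=> /(_ (measurable_itv _)) H; apply: le_trans (H _ _ _) _; first by lra.
- by move=> z Sz; rewrite /= in_itv/=; have := d1 _ _ Sp Sz; rewrite ler_norml; lra.
- move=> x _; apply: lebesgue_measure_diam_le => //; first exact: measurable_ysection.
  by move=> a b; rewrite /ysection/= !inE => Sa Sb; exact: (d2 _ _ Sa Sb).
- rewrite [leRHS]EFinM; apply: lee_pmul => //; first by rewrite lee_fin; lra.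
  exact: lebesgue_measure_itv_le.
Qed.

End PlanarSets.

(** * Separated points near a common circle *)

Section PlaneGeometry.
Variable R : realType.
Implicit Types (delta t r : R) (x z : R * R).

(* With alpha = 2 a.u and beta = 2 a.v the vector alpha v - beta u has length
   2 |a| |u x v|; if a, a + u, a + v lay on one circle about the origin then
   alpha = - |u|^2 and beta = - |v|^2, and its length would be |u| |v| |u - v|. *)
Lemma cross_sqr_ge (a1 a2 u1 u2 v1 v2 s e : R) : 0 <= e -> 4 * e <= s ->
  s <= u1 ^+ 2 + u2 ^+ 2 -> s <= v1 ^+ 2 + v2 ^+ 2 ->
  s <= (u1 - v1) ^+ 2 + (u2 - v2) ^+ 2 ->
  `|2 * (a1 * u1 + a2 * u2) + (u1 ^+ 2 + u2 ^+ 2)| <= e ->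
  `|2 * (a1 * v1 + a2 * v2) + (v1 ^+ 2 + v2 ^+ 2)| <= e ->
  s ^+ 3 <= 16 * (a1 ^+ 2 + a2 ^+ 2) * (u1 * v2 - u2 * v1) ^+ 2.
Proof.
move=> e0 es.
set U := u1 ^+ 2 + _; set V := v1 ^+ 2 + _; set W := (u1 - v1) ^+ 2 + _.
set eu := _ + U; set ev := _ + V.
move=> sU sV sW; rewrite !ler_norml => /andP[eu1 eu2] /andP[ev1 ev2].
have eue : eu ^+ 2 <= e ^+ 2 by nra.
have eve : ev ^+ 2 <= e ^+ 2 by nra.
(* [eu] and [ev] measure the failure of concyclicity. The vector alpha v - beta u splits into the
   exact part V u - U v, whose squared length is UVW, and the error eu v - ev u. *)
have key : U * V * W - 2 * ((eu * v1 - ev * u1) ^+ 2 + (eu * v2 - ev * u2) ^+ 2)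
    <= 8 * (a1 ^+ 2 + a2 ^+ 2) * (u1 * v2 - u2 * v1) ^+ 2.
  have -> : 8 * (a1 ^+ 2 + a2 ^+ 2) * (u1 * v2 - u2 * v1) ^+ 2 =
      2 * (((eu - U) * v1 - (ev - V) * u1) ^+ 2 + ((eu - U) * v2 - (ev - V) * u2) ^+ 2).
    by rewrite /eu /ev; ring.
  have -> : U * V * W = (V * u1 - U * v1) ^+ 2 + (V * u2 - U * v2) ^+ 2.
    by rewrite /U /V /W; ring.
  have sq (p q : R) : p ^+ 2 - 2 * q ^+ 2 <= 2 * (p + q) ^+ 2.
    by have := sqr_ge0 (p + 2 * q); nra.
  have := sq (V * u1 - U * v1) (eu * v1 - ev * u1).
  have := sq (V * u2 - U * v2) (eu * v2 - ev * u2).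
  set p1 := eu * v1 - _; set p2 := eu * v2 - _.
  set q1 := V * u1 - _; set q2 := V * u2 - _.
  have -> : (eu - U) * v1 - (ev - V) * u1 = q1 + p1 by rewrite /q1 /p1; ring.
  have -> : (eu - U) * v2 - (ev - V) * u2 = q2 + p2 by rewrite /q2 /p2; ring.
  lra.
have err : (eu * v1 - ev * u1) ^+ 2 + (eu * v2 - ev * u2) ^+ 2 <= 2 * e ^+ 2 * (U + V).
  have sq (p q : R) : (p - q) ^+ 2 <= 2 * p ^+ 2 + 2 * q ^+ 2.
    by have := sqr_ge0 (p + q); nra.
  have := sq (eu * v1) (ev * u1); have := sq (eu * v2) (ev * u2).
  rewrite !exprMn => h1 h2.
  have : eu ^+ 2 * V <= e ^+ 2 * V by apply: ler_wpM2r => //; lra.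
  have : ev ^+ 2 * U <= e ^+ 2 * U by apply: ler_wpM2r => //; lra.
  rewrite /U /V in h1 h2 *; nra.
(* Since U, V, W are at least s and 4 e is at most s, the total error 4 e^2 (U + V) is at most half
   of UVW, while UVW is at least s^3. *)
have UV : s * (U + V) <= 2 * (U * V) by nra.
have UVW : s * (U * V) <= U * V * W.
  by rewrite mulrC; apply: ler_wpM2l => //; apply: mulr_ge0; lra.
have s2 : 16 * e ^+ 2 <= s ^+ 2 by nra.
have e2UV : 16 * (e ^+ 2 * (U + V)) <= s ^+ 2 * (U + V).
  by rewrite mulrA; apply: ler_wpM2r => //; lra.
have : s * (s * (U + V)) <= s * (2 * (U * V)) by apply: ler_wpM2l => //; lra.
have : s * (s * s) <= s * (U * V).
  by apply: ler_wpM2l; [lra|apply: ler_pM; lra].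
rewrite -mulrA in err; rewrite mulrA -expr2.
have -> : s ^+ 3 = s * (s * s) by ring.
nra.
Qed.

Lemma enorm2_ge0 z : 0 <= enorm2 z. Proof. exact: sqrtr_ge0. Qed.

Lemma enorm2_sqr z : enorm2 z ^+ 2 = z.1 ^+ 2 + z.2 ^+ 2.
Proof. by rewrite sqr_sqrtr// addr_ge0// sqr_ge0. Qed.

(** The difference of squares factors: the two distances to the centre differ by at most 2 delta and
    add up to at most 5. *)
Lemma annulus_sqr delta x t z z' : t + delta <= 5 / 2 ->
  annulus delta x t z -> annulus delta x t z' ->
  `|((z.1 - x.1) ^+ 2 + (z.2 - x.2) ^+ 2)
    - ((z'.1 - x.1) ^+ 2 + (z'.2 - x.2) ^+ 2)| <= 10 * delta.
Proof.
move=> td; rewrite /annulus/= !ltr_norml => az az'.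
rewrite -!(enorm2_sqr (_ - x)).
have := enorm2_ge0 (z - x); have := enorm2_ge0 (z' - x).
move: (enorm2 (z - x)) (enorm2 (z' - x)) az az' => p q ap aq p0 q0.
by rewrite ler_norml; apply/andP; split; nra.
Qed.

(** A circle meets a line at most twice, so three separated points near it span a triangle of
    definite area. This is [cross_sqr_ge] with a = z1 - x, s = r^2 and e = 10 delta; the bound |a|
    <= 5/2 turns 16 |a|^2 into 100, hence the 10. *)
Lemma annulus_cross_ge delta x t r z1 z2 z3 : 0 <= delta -> 0 <= r ->
  t + delta <= 5 / 2 -> 40 * delta <= r ^+ 2 ->
  annulus delta x t z1 -> annulus delta x t z2 -> annulus delta x t z3 ->
  r <= `|z1 - z2| -> r <= `|z1 - z3| -> r <= `|z2 - z3| ->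
  r ^+ 3 / 10 <= `|(z2.1 - z1.1) * (z3.2 - z1.2) - (z2.2 - z1.2) * (z3.1 - z1.1)|.
Proof.
move=> d0 r0 td rd a1 a2 a3 r12 r13 r23.
have sqn (a : R) : r <= `|a| -> r ^+ 2 <= a ^+ 2.
  by move=> ra; rewrite -[a ^+ 2]real_normK ?num_real// ler_sqr// nnegrE.
have sq z z' : r <= `|z - z'| -> r ^+ 2 <= (z.1 - z'.1) ^+ 2 + (z.2 - z'.2) ^+ 2.
  have s0 := sqr_ge0 (z.1 - z'.1); have s1 := sqr_ge0 (z.2 - z'.2).
  rewrite prod_normE/= le_max => /orP[] h.
  - by have := sqn _ h; lra.
  - by have := sqn _ h; lra.
have := @cross_sqr_ge (z1.1 - x.1) (z1.2 - x.2) (z2.1 - z1.1) (z2.2 - z1.2)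
  (z3.1 - z1.1) (z3.2 - z1.2) (r ^+ 2) (10 * delta).
set D := _ * _ - _.
have h12 := sq _ _ r12; have h13 := sq _ _ r13; have h23 := sq _ _ r23.
have b12 := annulus_sqr td a2 a1; have b13 := annulus_sqr td a3 a1.
move=> H; have {H} : (r ^+ 2) ^+ 3 <=
    16 * ((z1.1 - x.1) ^+ 2 + (z1.2 - x.2) ^+ 2) * D ^+ 2.
  apply: H; [lra|lra|nra|nra|nra| |].
  - by congr (`|_| <= _): b12; ring.
  - by congr (`|_| <= _): b13; ring.
rewrite -(enorm2_sqr (z1 - x)) => H.
have Dr : (r ^+ 3 / 10) ^+ 2 <= `|D| ^+ 2.
  rewrite real_normK ?num_real//.
  have w0 := enorm2_ge0 (z1 - x).
  have w1 : enorm2 (z1 - x) ^+ 2 <= 25 / 4.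
    by move: a1; rewrite /annulus/= ltr_norml => /andP[_ ?]; nra.
  have : enorm2 (z1 - x) ^+ 2 * D ^+ 2 <= 25 / 4 * D ^+ 2.
    by apply: ler_wpM2r => //; exact: sqr_ge0.
  have -> : (r ^+ 3 / 10) ^+ 2 = (r ^+ 2) ^+ 3 / 100 by field.
  lra.
by move: Dr; rewrite ler_sqr// nnegrE// divr_ge0// exprn_ge0.
Qed.

End PlaneGeometry.

(** * Measurability of incidence and separation conditions *)

Section MeasurableSets.
Context d (T : measurableType d) (R : realType).
Implicit Types (f : T -> R) (z w c : T -> R * R).

Lemma measurable_sublevel f (a : R) : measurable_fun setT f ->
  measurable [set p | f p < a].
Proof.
move=> mf; have := mf measurableT `]-oo, a[%classic (measurable_itv _).
by rewrite setTI; congr measurable; apply/seteqP; split=> p /=; rewrite in_itv.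
Qed.

Lemma measurable_superlevel f (a : R) : measurable_fun setT f ->
  measurable [set p | a <= f p].
Proof.
move=> mf; have := mf measurableT `[a, +oo[%classic (measurable_itv _).
by rewrite setTI; congr measurable; apply/seteqP; split=> p /=; rewrite in_itv/= andbT.
Qed.

Lemma measurable_fst_sub z w : measurable_fun setT z -> measurable_fun setT w ->
  measurable_fun setT (fun p => (z p).1 - (w p).1).
Proof. by move=> mz mw; apply: measurable_funB; exact: measurableT_comp. Qed.

Lemma measurable_snd_sub z w : measurable_fun setT z -> measurable_fun setT w ->
  measurable_fun setT (fun p => (z p).2 - (w p).2).
Proof. by move=> mz mw; apply: measurable_funB; exact: measurableT_comp. Qed.

(** Centre, radius and point all vary with a parameter, so that this serves single annuli and
    incidence sets alike. *)
Lemma measurable_annulus (delta : R) c f z : measurable_fun setT c ->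
  measurable_fun setT f -> measurable_fun setT z ->
  measurable [set p | annulus delta (c p) (f p) (z p)].
Proof.
move=> mc mf mz; apply: measurable_sublevel.
apply: measurableT_comp => //; apply: measurable_funB => //.
apply: (@measurableT_comp _ _ _ _ _ _ (@Num.sqrt R)).
  exact: continuous_measurable_fun (@sqrt_continuous R).
apply: measurable_funD; apply: measurable_funX.
- exact: measurable_fst_sub.
- exact: measurable_snd_sub.
Qed.

Lemma measurable_sup_dist z w : measurable_fun setT z -> measurable_fun setT w ->
  measurable_fun setT (fun p => `|z p - w p|).
Proof.
move=> mz mw; under eq_fun do rewrite prod_normE/=.
apply: measurable_maxr; apply: measurableT_comp => //.
- exact: measurable_fst_sub.
- exact: measurable_snd_sub.
Qed.

End MeasurableSets.

(** * Measures of annuli and of their small pieces *)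

Section CircleMeasures.
Variable R : realType.
Implicit Types (delta t r : R) (x z : R * R).
Local Notation mu := (@lebesgue_measure R).
Local Notation mu2 := (mu \x mu)%E.
Local Notation mu3 := (mu \x mu \x mu)%E.

Lemma measurable_annulus_set delta x t : measurable (annulus delta x t).
Proof. by apply: (@measurable_annulus _ _ _ delta (cst x) (cst t) id). Qed.

Lemma measurable_square r z : measurable [set z' : R * R | `|z' - z| < r].
Proof.
by apply: measurable_sublevel; apply: (@measurable_sup_dist _ _ _ id (cst z)).
Qed.

(** Over each abscissa within 1 of the centre, the vertical segment of length delta just above the
    upper arc stays in the annulus: its height [s] over the centre is at most t, so s^2 + 2 s delta
    + delta^2 grows no faster than (t + delta)^2. *)
Lemma annulus_measure_ge delta x t : 0 < delta -> 1 <= t ->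
  ((2 * delta)%:E <= mu2 (annulus delta x t))%E.
Proof.
move=> d0 t1.
have := @le_product_measure1 _ _ _ _ _ mu mu (annulus delta x t)
  `[x.1 - 1, x.1 + 1] delta (measurable_annulus_set _ _ _) (measurable_itv _).
have mB : mu `[(x.1 - 1)%R, (x.1 + 1)%R] = 2%:E.
  rewrite lebesgue_measure_itv/= lte_fin; case: ifPn => [_|]; last by move=> /negP[]; lra.
  by rewrite -EFinB; congr EFin; lra.
move=> /(_ (ltW d0)); rewrite [X in (_ * X)%E]mB -EFinM mulrC; apply.
move=> u /=; rewrite in_itv/= => /andP[u1 u2].
set s := Num.sqrt (t ^+ 2 - (u - x.1) ^+ 2).
have s2 : s ^+ 2 = t ^+ 2 - (u - x.1) ^+ 2 by rewrite sqr_sqrtr//; nra.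
have s0 : 0 <= s by exact: sqrtr_ge0.
have -> : delta%:E = mu `](x.2 + s)%R, (x.2 + s + delta)%R[.
  rewrite lebesgue_measure_itv/= lte_fin; case: ifPn => [_|]; last by move=> /negP[]; lra.
  by rewrite -EFinB; congr EFin; lra.
apply: le_measure; rewrite ?inE//.
  by apply: measurable_xsection; exact: measurable_annulus_set.
move=> v /=; rewrite in_itv/= => /andP[v1 v2].
rewrite /xsection/= inE /annulus/=.
have := enorm2_sqr ((u, v) - x); have := enorm2_ge0 ((u, v) - x).
move: (enorm2 _) => p p0 /= p2.
have := sqr_ge0 (u - x.1) => a0.
have st : s <= t by rewrite -ler_sqr ?nnegrE; lra.
have w1 : s ^+ 2 <= (v - x.2) ^+ 2 by nra.
have w2 : (v - x.2) ^+ 2 < (s + delta) ^+ 2 by nra.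
have tp : t <= p by rewrite -ler_sqr ?nnegrE; lra.
have pt : p < t + delta by rewrite -ltr_sqr ?nnegrE; nra.
by rewrite ltr_norml; lra.
Qed.

(** Points of the annulus are more than 1/2 away from the centre, so some coordinate relative to it
    is at least 1/3 in absolute value. This gives four pieces. On each, the large coordinate is
    determined up to 15 delta by the other one, which varies by at most 2 r; each piece thus has
    measure at most 120 r delta. *)
Lemma annulus_square_measure_le delta x t z r : 0 < delta -> delta < 1 / 2 ->
  1 <= t <= 2 -> 0 < r ->
  (mu2 (annulus delta x t `&` [set z' | (`|z' - z| < r)%R]) <= (480 * r * delta)%:E)%E.
Proof.
move=> d0 d1 /andP[t1 t2] r0; set A := _ `&` _.
have mA : measurable A.
  by apply: measurableI; [exact: measurable_annulus_set|exact: measurable_square].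
have mfst (s : R) : measurable [set z' : R * R | 1 / 3 <= s * (z'.1 - x.1)].
  by apply: measurable_superlevel; apply: measurable_funM => //; apply: measurable_funB.
have msnd (s : R) : measurable [set z' : R * R | 1 / 3 <= s * (z'.2 - x.2)].
  by apply: measurable_superlevel; apply: measurable_funM => //; apply: measurable_funB.
pose S1 s := A `&` [set z' : R * R | 1 / 3 <= s * (z'.1 - x.1)].
pose S2 s := A `&` [set z' : R * R | 1 / 3 <= s * (z'.2 - x.2)].
have near p q : A p -> A q -> `|p.1 - q.1| <= 2 * r /\ `|p.2 - q.2| <= 2 * r.
  move=> [_ /=]; rewrite prod_normE/= gt_max => /andP[] /ltr_normlP[? ?] /ltr_normlP[? ?].
  move=> [_ /=]; rewrite prod_normE/= gt_max => /andP[] /ltr_normlP[? ?] /ltr_normlP[? ?].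
  by rewrite !ler_norml; lra.
have diff p q : A p -> A q ->
    `|((p.1 - x.1) ^+ 2 + (p.2 - x.2) ^+ 2) - ((q.1 - x.1) ^+ 2 + (q.2 - x.2) ^+ 2)|
      <= 10 * delta.
  by move=> [ap _] [aq _]; apply: annulus_sqr ap aq; lra.
(* The sign [s] makes both numbers at least 1/3, so |a + b| >= 2/3 can be divided out of |a^2 -
   b^2|, and 10 / (2/3) = 15. *)
have root (s a b : R) : s ^+ 2 = 1 -> 1 / 3 <= s * a -> 1 / 3 <= s * b ->
    `|a ^+ 2 - b ^+ 2| <= 10 * delta -> `|a - b| <= 15 * delta.
  move=> s2 sa sb; have -> : a ^+ 2 - b ^+ 2 = (a - b) * (s * (s * a + s * b)).
    by rewrite mulrDr !mulrA -expr2 s2; ring.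
  have s1 : `|s| = 1 by apply/eqP; rewrite -sqrp_eq1 ?real_normK ?num_real ?s2.
  rewrite !normrM s1 mul1r [`|s * a + _|]ger0_norm; last by lra.
  by have := normr_ge0 (a - b); nra.
have m1 s : s ^+ 2 = 1 -> (mu2 (S1 s) <= (120 * r * delta)%:E)%E.
  move=> s2.
  have -> : 120 * r * delta = 2 * (15 * delta) * (2 * (2 * r)) by ring.
  apply: lebesgue2_diam_le2; [exact: measurableI|lra|lra| |].
  - by move=> p q [Ap _] [Aq _]; have [] := near _ _ Ap Aq.
  - move=> p q [Ap /= hp] [Aq /= hq] pq; have := diff _ _ Ap Aq; rewrite pq => h.
    have -> : p.1 - q.1 = (p.1 - x.1) - (q.1 - x.1) by ring.
    by apply: (root s) => //; congr (`|_| <= _): h; ring.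
have m2 s : s ^+ 2 = 1 -> (mu2 (S2 s) <= (120 * r * delta)%:E)%E.
  move=> s2.
  have -> : 120 * r * delta = 2 * (15 * delta) * (2 * (2 * r)) by ring.
  apply: lebesgue2_diam_le; [exact: measurableI|lra|lra| |].
  - by move=> p q [Ap _] [Aq _]; have [] := near _ _ Ap Aq.
  - move=> p q [Ap /= hp] [Aq /= hq] pq; have := diff _ _ Ap Aq; rewrite pq => h.
    have -> : p.2 - q.2 = (p.2 - x.2) - (q.2 - x.2) by ring.
    by apply: (root s) => //; congr (`|_| <= _): h; ring.
have mS1 s : measurable (S1 s) by exact: measurableI.
have mS2 s : measurable (S2 s) by exact: measurableI.
have mU (U V : set (R * R)) : measurable U -> measurable V -> measurable (U `|` V).
  exact: measurableU.
have cover : A `<=` (S1 1 `|` S1 (-1)) `|` (S2 1 `|` S2 (-1)).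
  move=> p Ap; apply: contrapT; rewrite /S1 /S2 => nS.
  have {}nS : [/\ 1 * (p.1 - x.1) < 1 / 3, -1 * (p.1 - x.1) < 1 / 3,
      1 * (p.2 - x.2) < 1 / 3 & -1 * (p.2 - x.2) < 1 / 3].
    by split; rewrite ltNge; apply/negP => h; apply: nS; [left; left|left; right
      |right; left|right; right].
  case: nS => n1 n2 n3 n4; case: Ap => + _; rewrite /annulus/= ltr_norml.
  have := enorm2_sqr (p - x); have := enorm2_ge0 (p - x).
  by move: (enorm2 _) => w w0 /= w2 /andP[w3 _]; nra.
apply: (@le_trans _ _ (mu2 ((S1 1 `|` S1 (-1)) `|` (S2 1 `|` S2 (-1))))).
  by apply: le_measure; rewrite ?inE//; exact: mU _ _ (mU _ _ _ _) (mU _ _ _ _).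
have -> : (480 * r * delta)%:E = ((120 * r * delta)%:E + (120 * r * delta)%:E
    + ((120 * r * delta)%:E + (120 * r * delta)%:E))%E.
  by rewrite -!EFinD; congr EFin; ring.
have sub (U V : set (R * R)) (mU' : measurable U) (mV : measurable V) :
    (mu2 (U `|` V) <= mu2 U + mu2 V)%E by exact: (measureU2 mu2 mU' mV).
apply: (le_trans (sub _ _ (mU _ _ _ _) (mU _ _ _ _))) => //.
by apply: leeD; apply: (le_trans (sub _ _ _ _)) => //; apply: leeD;
  [apply: m1|apply: m1|apply: m2|apply: m2]; rewrite ?sqrrN expr1n.
Qed.

Lemma lebesgue3_slab_le (Q : set (R * R * R)) (P : set (R * R)) (L c : R) :
  measurable Q -> measurable P -> 0 <= L -> (forall p, Q p -> P p.1) ->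
  (forall x t t', Q (x, t) -> Q (x, t') -> `|t - t'| <= L) ->
  (mu2 P <= c%:E)%E -> (mu3 Q <= (2 * L * c)%:E)%E.
Proof.
move=> mQ mP L0 QP dQ Pc.
have := @product_measure1_le _ _ _ _ _ mu2 mu Q P (2 * L) mQ mP.
move=> H; apply: le_trans (H _ QP _) _; first by lra.
- move=> x _; apply: lebesgue_measure_diam_le => //; first exact: measurable_xsection.
  by move=> a b; rewrite /xsection/= !inE; exact: dQ.
- by rewrite [leRHS]EFinM; apply: lee_wpmul2l => //; rewrite lee_fin; lra.
Qed.

End CircleMeasures.

(** * Circles passing near three separated points *)

Section CirclesThroughThreePoints.
Variable R : realType.
Implicit Types (delta t r : R) (x z : R * R).
Local Notation mu := (@lebesgue_measure R).
Local Notation mu2 := (mu \x mu)%E.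
Local Notation mu3 := (mu \x mu \x mu)%E.

Definition circles_through delta z1 z2 z3 : set (R * R * R) :=
  [set p | 1 <= p.2 <= 2 /\ [/\ annulus delta p.1 p.2 z1,
    annulus delta p.1 p.2 z2 & annulus delta p.1 p.2 z3]].

Lemma measurable_circles_through d (T : measurableType d) delta
    (z1 z2 z3 : T -> R * R) (p : T -> R * R * R) :
  measurable_fun setT z1 -> measurable_fun setT z2 -> measurable_fun setT z3 ->
  measurable_fun setT p ->
  measurable [set q | circles_through delta (z1 q) (z2 q) (z3 q) (p q)].
Proof.
move=> m1 m2 m3 mp.
have mt : measurable_fun setT (fun q => (p q).2) by exact: measurableT_comp.
have ma (z : T -> R * R) : measurable_fun setT z ->
    measurable [set q | annulus delta (p q).1 (p q).2 (z q)].
  by move=> mz; apply: (@measurable_annulus _ _ _ delta (fun q => (p q).1)) => //;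
    exact: measurableT_comp.
have -> : [set q | circles_through delta (z1 q) (z2 q) (z3 q) (p q)] =
    ([set q | 1 <= (p q).2] `&` [set q | - 2 <= - (p q).2]) `&`
    ([set q | annulus delta (p q).1 (p q).2 (z1 q)] `&`
    ([set q | annulus delta (p q).1 (p q).2 (z2 q)] `&`
     [set q | annulus delta (p q).1 (p q).2 (z3 q)])).
  apply/seteqP; split=> q; rewrite /circles_through/= lerN2.
    by move=> [/andP[? ?] []].
  by move=> [[? ?] [? [? ?]]]; split=> //; apply/andP.
apply: measurableI; first apply: measurableI.
- exact: measurable_superlevel.
- by apply: measurable_superlevel; exact: measurable_funN.
- by apply: measurableI; [exact: ma|apply: measurableI; exact: ma].
Qed.

Lemma measurable_equidistant (c : R) z z' : measurable
  [set x : R * R | `|((z.1 - x.1) ^+ 2 + (z.2 - x.2) ^+ 2)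
    - ((z'.1 - x.1) ^+ 2 + (z'.2 - x.2) ^+ 2)| <= c].
Proof.
pose f x := `|((z.1 - x.1) ^+ 2 + (z.2 - x.2) ^+ 2)
  - ((z'.1 - x.1) ^+ 2 + (z'.2 - x.2) ^+ 2)|.
rewrite (_ : mkset _ = ~` [set x | f x > c]); last first.
  by apply/seteqP; split=> x /=; rewrite leNgt => /negP.
apply: measurableC.
have -> : [set x | f x > c] = [set x | - f x < - c].
  by apply/seteqP; split=> x /=; rewrite ltrN2.
apply: measurable_sublevel; apply: measurable_funN; apply: measurableT_comp => //.
by apply: measurable_funB; apply: measurable_funD; apply: measurable_funX; apply: measurable_funB.
Qed.

(** For a fixed centre the radius varies by at most 2 delta, so it remains to bound the set of
    centres. The constant is that of the regime r^2 <= 40 delta; the other regime yields 32000. *)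
Lemma circles_through_measure_le delta r z1 z2 z3 : 0 < delta -> delta < 1 / 2 -> 0 < r ->
  r <= `|z1 - z2| -> r <= `|z1 - z3| -> r <= `|z2 - z3| ->
  (mu3 (circles_through delta z1 z2 z3) <= (40 * 960 * (delta / r) ^+ 3)%:E)%E.
Proof.
move=> d0 d1 r0 r12 r13 r23; set Q := circles_through _ _ _ _.
have mQ : measurable Q.
  exact: (@measurable_circles_through _ _ delta (cst z1) (cst z2) (cst z3) id).
have dQ x t t' : Q (x, t) -> Q (x, t') -> `|t - t'| <= 2 * delta.
  move=> [_ []]; rewrite /annulus/= => + _ _ [_ []] + _ _; rewrite /annulus/=.
  by rewrite ler_norml !ltr_norml; lra.
pose h z z' x : R := ((z.1 - x.1) ^+ 2 + (z.2 - x.2) ^+ 2)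
    - ((z'.1 - x.1) ^+ 2 + (z'.2 - x.2) ^+ 2).
have hQ p : Q p -> `|h z1 z2 p.1| <= 10 * delta /\ `|h z1 z3 p.1| <= 10 * delta.
  by move=> [/andP[_ t2] [a1 a2 a3]]; split; apply: (annulus_sqr (t := p.2)) => //; lra.
have mh z z' : measurable [set x | `|h z z' x| <= 10 * delta].
  exact: measurable_equidistant.
(* The strip depends affinely on the centre: its gradient is 2 (z' - z). *)
have hB z z' x y : `|h z z' x| <= 10 * delta -> `|h z z' y| <= 10 * delta ->
    `|(z'.1 - z.1) * (x.1 - y.1) + (z'.2 - z.2) * (x.2 - y.2)| <= 10 * delta.
  move=> hx hy; set s := _ + _.
  have -> : s = (h z z' x - h z z' y) / 2 by rewrite /s /h; field.
  by move: hx hy; rewrite !ler_norml; lra.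
(* At separation below sqrt(40 delta) three points of an annulus can be
   collinear; there one strip already suffices. Otherwise two strips meet in a
   parallelogram, whose determinant annulus_cross_ge controls. *)
have [rd|rd] := leP (r ^+ 2) (40 * delta).
  (* A single strip has infinite measure; it is truncated by a square about [z1], which contains all
     centres because t + delta < 5/2. *)
  pose P := [set x : R * R | `|x - z1| < 3] `&` [set x | `|h z1 z2 x| <= 10 * delta].
  have mP : measurable P by apply: measurableI; [exact: measurable_square|].
  have QP p : Q p -> P p.1.
    move=> Qp; split; last by have [] := hQ _ Qp.
    case: Qp => /andP[_ t2] [a1 _ _] /=; rewrite distrC prod_normE/=.
    move: a1; rewrite /annulus/= ltr_norml => /andP[_].
    have := enorm2_sqr (z1 - p.1); have := enorm2_ge0 (z1 - p.1).
    move: (enorm2 _) => w w0 /= w2 w1.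
    have w3 : w ^+ 2 < 3 ^+ 2 by nra.
    have := sqr_ge0 (z1.1 - p.1.1); have := sqr_ge0 (z1.2 - p.1.2) => s1 s2.
    by rewrite gt_max; apply/andP; split; rewrite -ltr_sqr ?nnegrE// real_normK ?num_real//; lra.
  have box p q : P p -> P q -> `|p.1 - q.1| <= 6 /\ `|p.2 - q.2| <= 6.
    move=> [/= + _] [/= + _]; rewrite !prod_normE/= !gt_max !ltr_norml !ler_norml; lra.
  have slope (a b : R) : r <= `|a| -> `|a * b| <= 10 * delta -> `|b| <= 10 * delta / r.
    rewrite normrM => ra ab; rewrite ler_pdivlMr// mulrC.
    by apply: le_trans ab; apply: ler_wpM2r.
  have P2 : (mu2 P <= (2 * (10 * delta / r) * (2 * 6))%:E)%E.
    have L0 : 0 <= 10 * delta / r by rewrite divr_ge0; lra.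
    (* Some coordinate of z2 - z1 is at least r in absolute value; the strip is thin in that
       direction. *)
    move: (r12); rewrite distrC prod_normE/= le_max => /orP[rz|rz].
    - apply: lebesgue2_diam_le2 => // p q Pp Pq; first by have [] := box _ _ Pp Pq.
      move=> pq; apply: slope rz _; have := hB _ _ _ _ Pp.2 Pq.2.
      by rewrite pq subrr mulr0 addr0.
    - apply: lebesgue2_diam_le => // p q Pp Pq; first by have [] := box _ _ Pp Pq.
      move=> pq; apply: slope rz _; have := hB _ _ _ _ Pp.2 Pq.2.
      by rewrite pq subrr mulr0 add0r.
  apply: le_trans (lebesgue3_slab_le mQ mP _ QP dQ P2) _; first by lra.
  rewrite lee_fin; set e := delta / r.
  have -> : 2 * (2 * delta) * (2 * (10 * delta / r) * (2 * 6)) = 960 * e ^+ 3 * (r ^+ 2 / delta).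
    by rewrite /e; field; rewrite !gt_eqF.
  have : r ^+ 2 / delta <= 40 by rewrite ler_pdivrMr.
  have : 0 <= e ^+ 3 by rewrite exprn_ge0// divr_ge0// ltW.
  by nra.
(* A member of [Q] provides the annulus containing the three points that the lower bound on the
   determinant requires. *)
have [->|/set0P[p0 Qp0]] := eqVneq Q set0.
  rewrite measure0 lee_fin.
  have : 0 <= (delta / r) ^+ 3 by rewrite exprn_ge0// divr_ge0// ltW.
  by lra.
pose D := (z2.1 - z1.1) * (z3.2 - z1.2) - (z2.2 - z1.2) * (z3.1 - z1.1).
have Dr : r ^+ 3 / 10 <= `|D|.
  case: Qp0 => /andP[_ t2] [a1 a2 a3].
  by apply: (annulus_cross_ge (delta := delta) (x := p0.1) (t := p0.2)) => //; lra.
have D0 : 0 < `|D| by apply: lt_le_trans Dr; rewrite divr_gt0// exprn_gt0.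
pose P := [set x | `|h z1 z2 x| <= 10 * delta] `&` [set x | `|h z1 z3 x| <= 10 * delta].
have mP : measurable P by exact: measurableI.
have QP p : Q p -> P p.1 by move=> /hQ[].
(* Cramer's rule confines the first coordinate of the centre to length 20 delta m / |D|; once it is
   fixed, the strip whose second coefficient has size [m] confines the other to 10 delta / m. The
   two occurrences of [m] cancel in the area. *)
pose m := Num.max `|z2.2 - z1.2| `|z3.2 - z1.2|.
have m0 : 0 < m.
  rewrite lt_max !normr_gt0 -negb_and; apply/negP => /andP[/eqP e1 /eqP e2].
  by move: D0; rewrite /D e1 e2 mulr0 mul0r subr0 normr0 ltxx.
have P2 : (mu2 P <= (2 * (10 * delta / m) * (2 * (20 * delta * m / `|D|)))%:E)%E.
  apply: lebesgue2_diam_le => //.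
  - by rewrite divr_ge0// !mulr_ge0// ltW.
  - by rewrite divr_ge0 ?mulr_ge0// ltW.
  - move=> p q [p2 p3] [q2 q3]; rewrite ler_pdivlMr// mulrC -normrM.
    have b2 := hB _ _ _ _ p2 q2; have b3 := hB _ _ _ _ p3 q3.
    set s2 := _ + _ in b2; set s3 := _ + _ in b3.
    have -> : D * (p.1 - q.1) = (z3.2 - z1.2) * s2 - (z2.2 - z1.2) * s3.
      by rewrite /D /s2 /s3; ring.
    apply: (le_trans (ler_normB _ _)); rewrite !normrM.
    have n2 : `|z2.2 - z1.2| <= m by rewrite le_max lexx.
    have n3 : `|z3.2 - z1.2| <= m by rewrite le_max lexx orbT.
    have : `|z3.2 - z1.2| * `|s2| <= m * (10 * delta) by apply: ler_pM.
    have : `|z2.2 - z1.2| * `|s3| <= m * (10 * delta) by apply: ler_pM.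
    lra.
  - move=> p q [p2 p3] [q2 q3] pq; rewrite ler_pdivlMr//.
    have := hB _ _ _ _ p2 q2; have := hB _ _ _ _ p3 q3.
    rewrite pq subrr !mulr0 !add0r !normrM => b3 b2.
    by rewrite mulrC /m /Order.max; case: ifP.
apply: le_trans (lebesgue3_slab_le mQ mP _ QP dQ P2) _; first by lra.
rewrite lee_fin.
have -> : 2 * (2 * delta) * (2 * (10 * delta / m) * (2 * (20 * delta * m / `|D|)))
    = 3200 * delta ^+ 3 / `|D|.
  by field; rewrite !gt_eqF.
rewrite expr_div_n ler_pdivrMr//.
have e0 : 0 <= delta ^+ 3 / r ^+ 3 by rewrite divr_ge0// exprn_ge0// ltW.
have : delta ^+ 3 / r ^+ 3 * (r ^+ 3 / 10) <= delta ^+ 3 / r ^+ 3 * `|D|.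
  exact: ler_wpM2l.
have -> : delta ^+ 3 / r ^+ 3 * (r ^+ 3 / 10) = delta ^+ 3 / 10.
  by field; rewrite gt_eqF.
have : 0 <= delta ^+ 3 / r ^+ 3 * `|D| by rewrite mulr_ge0.
by lra.
Qed.

End CirclesThroughThreePoints.

(** * Measurable hulls for the outer measure *)

Lemma measurable_hull d (T : measurableType d) (R : realType)
    (m : {measure set T -> \bar R}) (E : set T) :
  exists G, [/\ measurable G, E `<=` G & (m G <= m^*%mu E)%E].
Proof.
have [->|Efin] := eqVneq (m^*%mu E) +oo%E; first by exists setT; rewrite leey.
have {}Efin : m^*%mu E \is a fin_num.
  by rewrite ge0_fin_numE ?ltey// mu_ext_ge0.
(* Countable measurable covers that are optimal up to 1/(n+1); the hull is the intersection of their
   unions. *)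
have approx n : exists G,
    [/\ measurable G, E `<=` G & (m G <= m^*%mu E + n.+1%:R^-1%:E)%E].
  have n0 : 0 < n.+1%:R^-1 :> R by rewrite invr_gt0.
  have [_ [F [mF EF] <-] /ltW Fn] := lb_ereal_inf_adherent n0 Efin.
  exists (\bigcup_k F k); split=> //; first exact: bigcup_measurable.
  apply: le_trans Fn; apply: measure_sigma_subadditive => //.
  exact: bigcup_measurable.
have [G GP] := choice approx.
have mG : measurable (\bigcap_n G n) by apply: bigcap_measurable => // n _; case: (GP n).
exists (\bigcap_n G n); split=> //; first by move=> x Ex n _; have [_ + _] := GP n; exact.
apply/lee_addgt0Pr => e e0.
have [n ne] : exists n, n.+1%:R^-1 <= e.
  exists (Num.truncn e^-1); rewrite invf_ple ?posrE//.
  exact/ltW/truncnS_gt.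
have [mGn _ Gn] := GP n.
apply: (@le_trans _ _ (m (G n))).
  by apply: le_measure; rewrite ?inE// => x; exact.
by apply: (le_trans Gn); rewrite leeD2l// lee_fin.
Qed.

(** * Incidences between rich circles and separated triples *)

Section RichCircles.
Variable R : realType.
Implicit Types (delta lambda t r : R) (x z : R * R) (G : set (R * R)).
Local Notation mu := (@lebesgue_measure R).
Local Notation mu2 := (mu \x mu)%E.
Local Notation mu3 := (mu \x mu \x mu)%E.
Local Notation smu2 := (sf_product mu mu).
Local Notation smu3 := (sf_product smu2 mu).
Local Notation mu6 := (sf_product (sf_product smu2 smu2) smu2).

(* The two excluded squares cost at most 480 r delta each, which for
   r = lambda / 960 adds up to half of 2 lambda delta. *)
Lemma annulus_far_measure_ge delta lambda x t (A : set (R * R)) z1 z2 :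
  0 < delta -> delta < 1 / 2 -> 0 < lambda -> 1 <= t <= 2 ->
  measurable A -> A `<=` annulus delta x t -> ((2 * lambda * delta)%:E <= mu2 A)%E ->
  ((lambda * delta)%:E <= mu2 (A `&` ([set z | (lambda / 960 <= `|z1 - z|)%R] `&`
     [set z | (lambda / 960 <= `|z2 - z|)%R])))%E.
Proof.
move=> d0 d1 l0 t12 mA Aann lA; set S := A `&` _.
pose N z0 : set (R * R) := annulus delta x t `&` [set z | `|z - z0| < lambda / 960].
have mN z0 : measurable (N z0).
  by apply: measurableI; [exact: measurable_annulus_set|exact: measurable_square].
have mfar z0 : measurable [set z | lambda / 960 <= `|z0 - z|].
  by apply: measurable_superlevel; apply: (@measurable_sup_dist _ _ _ (cst z0) id).
have mS : measurable S by apply: measurableI => //; exact: measurableI.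
have Nle z0 : (mu2 (N z0) <= (lambda * delta / 2)%:E)%E.
  have := @annulus_square_measure_le _ delta x t z0 (lambda / 960) d0 d1 t12.
  by move=> /(_ ltac:(lra)); congr (_ <= EFin _)%E; field.
have cover : A `<=` S `|` (N z1 `|` N z2).
  move=> z Az; have [h1|h1] := leP (lambda / 960) `|z1 - z|; last first.
    by right; left; split; [exact: Aann|rewrite /= distrC].
  have [h2|h2] := leP (lambda / 960) `|z2 - z|; first by left.
  by right; right; split; [exact: Aann|rewrite /= distrC].
have mU (U V : set (R * R)) : measurable U -> measurable V -> measurable (U `|` V).
  exact: measurableU.
have sub (U V : set (R * R)) (mU' : measurable U) (mV : measurable V) :
    (mu2 (U `|` V) <= mu2 U + mu2 V)%E by exact: (measureU2 mu2 mU' mV).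
have {cover} : (mu2 A <= mu2 S + (mu2 (N z1) + mu2 (N z2)))%E.
  apply: (@le_trans _ _ (mu2 (S `|` (N z1 `|` N z2)))).
    by apply: le_measure; rewrite ?inE//; exact: mU _ _ mS (mU _ _ (mN _) (mN _)).
  apply: (le_trans (sub _ _ mS (mU _ _ (mN _) (mN _)))).
  by rewrite leeD2l// sub.
move=> /(le_trans lA); have := leeD (Nle z1) (Nle z2).
set n12 := (_ + _)%E; rewrite -EFinD => n12le.
move=> /le_trans /(_ (leeD2l _ n12le)).
have : (0 <= mu2 S)%E by [].
case: (mu2 S) => [s| |] //; rewrite ?leey// !lee_fin; lra.
Qed.

(** The denominator of [richset] is replaced by its lower bound 2 delta, which enlarges the set and
    leaves a condition on one measure only. *)
Definition rich_borel delta lambda (G : set (R * R)) : set (R * R * R) :=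
  [set p | 1 <= p.2 <= 2 /\
    ((2 * lambda * delta)%:E < mu2 (annulus delta p.1 p.2 `&` G))%E].

(** The measure of the annulus inside [G] is that of a section of one measurable incidence set,
    hence a measurable function of the circle. *)
Lemma measurable_rich_borel delta lambda G : measurable G ->
  measurable (rich_borel delta lambda G).
Proof.
move=> mG.
have mS : measurable [set q : (R * R * R) * (R * R) |
    annulus delta q.1.1 q.1.2 q.2 /\ G q.2].
  apply: measurableI.
    apply: (@measurable_annulus _ _ _ delta (fun q : (R * R * R) * (R * R) => q.1.1)
      (fun q => q.1.2) snd) => //; exact: measurableT_comp.
  by rewrite -[X in measurable X]setTI; apply: measurable_snd.
have mf := measurable_fun_xsection smu2 mS.
have mX := mf measurableT `](2 * lambda * delta)%:E, +oo[%classic (emeasurable_itv _).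
have mt : measurable_fun setT (fun p : R * R * R => p.2) by exact: measurable_snd.
have m1 := measurable_superlevel 1 mt.
have m2 := measurable_superlevel (- 2) (measurable_funN mt).
have eS p : xsection [set q : (R * R * R) * (R * R) |
    annulus delta q.1.1 q.1.2 q.2 /\ G q.2] p = annulus delta p.1 p.2 `&` G.
  by apply/seteqP; split=> z; rewrite /xsection/= inE.
have := measurableI _ _ (measurableI _ _ m1 m2) mX.
congr measurable; apply/seteqP; split=> p;
  rewrite /rich_borel/= in_itv/= andbT lerN2 eS.
  by move=> [[? ?] [_ ?]]; split=> //; apply/andP.
by move=> [/andP[? ?] ?].
Qed.

(** The incidence set [W] of circles and separated triples is measured twice: by slices over circles
    from below, by slices over triples from above. *)
Lemma rich_borel_measure_le delta lambda G : 0 < delta -> delta < 1 / 2 ->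
  0 < lambda -> measurable G ->
  ((lambda ^+ 6)%:E * mu3 (rich_borel delta lambda G) <=
    (40 * 960 ^+ 4)%:E * (mu2 G * mu2 G * mu2 G))%E.
Proof.
move=> d0 d1 l0 mG; set F := rich_borel _ _ _; set r := lambda / 960.
have r0 : 0 < r by rewrite /r; lra.
pose far z z' := r <= `|z - z'|.
pose G3 := (G `*` G) `*` G.
pose sep (z1 z2 z3 : R * R) := [/\ far z1 z2, far z1 z3 & far z2 z3].
pose W : set ((R * R * R) * ((R * R) * (R * R) * (R * R))) :=
  ([set q | circles_through delta q.2.1.1 q.2.1.2 q.2.2 q.1] `&` [set q | G3 q.2]) `&`
  [set q | sep q.2.1.1 q.2.1.2 q.2.2].
have mfst : measurable_fun setT (fun q : (R * R * R) * ((R * R) * (R * R) * (R * R)) => q.1).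
  exact: measurable_fst.
have mz3 : measurable_fun setT (fun q : (R * R * R) * ((R * R) * (R * R) * (R * R)) => q.2.2).
  exact: measurableT_comp.
have mz12 : measurable_fun setT (fun q : (R * R * R) * ((R * R) * (R * R) * (R * R)) => q.2.1).
  exact: measurableT_comp.
have mz1 : measurable_fun setT (fun q : (R * R * R) * ((R * R) * (R * R) * (R * R)) => q.2.1.1).
  exact: measurableT_comp.
have mz2 : measurable_fun setT (fun q : (R * R * R) * ((R * R) * (R * R) * (R * R)) => q.2.1.2).
  exact: measurableT_comp.
have mG3 : measurable G3 by apply: measurableX => //; exact: measurableX.
have mW : measurable W.
  apply: measurableI.
    apply: measurableI; first exact: measurable_circles_through.
    by rewrite -[X in measurable X]setTI; apply: measurable_snd.
  have mf12 := measurable_superlevel r (measurable_sup_dist mz1 mz2).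
  have mf13 := measurable_superlevel r (measurable_sup_dist mz1 mz3).
  have mf23 := measurable_superlevel r (measurable_sup_dist mz2 mz3).
  have := measurableI _ _ (measurableI _ _ mf12 mf13) mf23.
  by congr measurable; apply/seteqP; split=> q; [case=> [[]]|case].
have mF : measurable F by exact: measurable_rich_borel.
have lower : (((lambda * delta) ^+ 3)%:E * mu3 F <= (smu3 \x mu6) W)%E.
  have ld0 : 0 <= lambda * delta by rewrite mulr_ge0// ltW.
  apply: le_product_measure1 => //; first exact: exprn_ge0.
  move=> p [p12 pG]; set S3 := xsection W p.
  have mS3 : measurable S3 by exact: measurable_xsection.
  pose A := annulus delta p.1 p.2 `&` G.
  have mA : measurable A by apply: measurableI => //; exact: measurable_annulus_set.
  have Afar z1 z2 :
      ((lambda * delta)%:E <= mu2 (A `&` ([set z | far z1 z] `&` [set z | far z2 z])))%E.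
    apply: (annulus_far_measure_ge (x := p.1) (t := p.2)) => //; last exact: ltW.
    exact: subIsetl.
  (* The triple is chosen one point at a time, and each choice contributes a factor lambda delta.
     The second point has a single point to avoid, so [Afar] is applied with that point twice. *)
  pose S2 := (A `*` A) `&` [set z | far z.1 z.2].
  have mS2 : measurable S2.
    apply: measurableI; first exact: measurableX.
    by apply: measurable_superlevel; exact: measurable_sup_dist.
  have SS2 : ((lambda * delta)%:E * smu2 A <= (smu2 \x smu2) S2)%E.
    apply: le_product_measure1 => // z1 Az1.
    apply: (le_trans (Afar z1 z1)); apply: le_measure; rewrite ?inE.
    - apply: measurableI => //; apply: measurableI;
      by apply: measurable_superlevel; apply: (@measurable_sup_dist _ _ _ (cst z1) id).
    - exact: measurable_xsection.
    - by move=> z [Az [_ h]]; rewrite /xsection/= inE.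
  have SS3 : ((lambda * delta)%:E * (smu2 \x smu2) S2 <= mu6 S3)%E.
    apply: le_product_measure1 => // -[z1 z2] [[Az1 Az2] h12].
    apply: (le_trans (Afar z1 z2)); apply: le_measure; rewrite ?inE.
    - apply: measurableI => //; apply: measurableI;
      by apply: measurable_superlevel; apply: (@measurable_sup_dist _ _ _ (cst _) id).
    - exact: measurable_xsection.
    - move=> z [Az [h1 h2]]; rewrite /xsection/=; apply/mem_set.
      rewrite /S3 /xsection/=; apply/mem_set; split; last by split.
      by split; [split=> //; split; [case: Az1|case: Az2|case: Az]
        |split; [split; [case: Az1|case: Az2]|case: Az]].
  apply: le_trans SS3; rewrite exprS EFinM; apply: lee_wpmul2l; rewrite ?lee_fin//.
  apply: le_trans SS2; rewrite expr2 EFinM; apply: lee_wpmul2l; rewrite ?lee_fin//.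
  (* The first point is unconstrained: the origin is an arbitrary choice, and monotonicity gives the
     bound for all of [A]. *)
  have /le_trans := Afar (0, 0) (0, 0); apply; apply: le_measure; rewrite ?inE//.
  apply: measurableI => //; apply: measurableI;
    by apply: measurable_superlevel; apply: (@measurable_sup_dist _ _ _ (cst _) id).
have upper : ((smu3 \x mu6) W <= (40 * 960 * (delta / r) ^+ 3)%:E * mu6 G3)%E.
  have e0 : 0 <= (delta / r) ^+ 3 by rewrite exprn_ge0// divr_ge0// ltW.
  have M0 : 0 <= 40 * 960 * (delta / r) ^+ 3 by lra.
  apply: (@product_measure1_le2 _ _ _ _ _ smu3 mu6 _ _ _ mW mG3 M0); first by move=> z [[]].
  move=> [[z1 z2] z3] _; set Y := ysection W _.
  have mY : measurable Y by exact: measurable_ysection.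
  have [[f12 f13 f23]|nf] := pselect [/\ far z1 z2, far z1 z3 & far z2 z3].
    apply: le_trans (circles_through_measure_le d0 d1 r0 f12 f13 f23).
    apply: le_measure; rewrite ?inE//.
      exact: (@measurable_circles_through _ _ _ delta (cst z1) (cst z2) (cst z3) id).
    by move=> p; rewrite /Y /ysection/= inE => -[[]].
  have -> : Y = set0.
    by apply/seteqP; split=> p //; rewrite /Y /ysection/= inE => -[].
  by rewrite measure0 lee_fin; lra.
have mu6G : mu6 G3 = (mu2 G * mu2 G * mu2 G)%E.
  rewrite [LHS](product_measure1E (sf_product smu2 smu2) smu2 (measurableX mG mG) mG).
  by congr (_ * _)%E; exact: (product_measure1E smu2 smu2 mG mG).
have {lower upper} := le_trans lower upper; rewrite mu6G => H.
(* This factor removes delta from both sides: (lambda delta)^3 becomes lambda^6, and (delta / r)^3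
   becomes 960^3. *)
have c0 : (0 <= (lambda ^+ 3 / delta ^+ 3)%:E)%E.
  by rewrite lee_fin divr_ge0// exprn_ge0// ltW.
have := lee_wpmul2l c0 H; rewrite !muleA -!EFinM.
have -> : lambda ^+ 3 / delta ^+ 3 * (lambda * delta) ^+ 3 = lambda ^+ 6.
  by field; rewrite gt_eqF.
suff -> : lambda ^+ 3 / delta ^+ 3 * (40 * 960 * (delta / r) ^+ 3) = 40 * 960 ^+ 4 by [].
have : 960 != 0 :> R by rewrite pnatr_eq0.
rewrite /r; move: (960 : R) => n n0.
by field; rewrite n0 !gt_eqF.
Qed.

End RichCircles.

(** * Passage to the Borel hull and the sixth root *)

Lemma richset_sub_borel (R : realType) (delta lambda : R) (E G : set (R * R)) :
  0 < delta -> 0 < lambda -> measurable G -> E `<=` G ->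
  richset delta lambda E `<=` rich_borel delta lambda G.
Proof.
move=> d0 l0 mG EG p [p12 ratio]; split=> //.
set mu2 := (@lebesgue_measure R \x @lebesgue_measure R)%E.
have mA := measurable_annulus_set delta p.1 p.2.
have num : (lebesgue2 (annulus delta p.1 p.2 `&` E) <= mu2 (annulus delta p.1 p.2 `&` G))%E.
  apply: (@le_trans _ _ (lebesgue2 (annulus delta p.1 p.2 `&` G))).
    by apply: le_mu_ext; exact: setIS.
  by rewrite [leLHS](measurable_mu_extE mu2 (measurableI _ _ mA mG)).
have den : ((2 * delta)%:E <= lebesgue2 (annulus delta p.1 p.2))%E.
  rewrite [leRHS](measurable_mu_extE mu2 mA).
  by apply: annulus_measure_ge => //; case/andP: p12.
apply: lt_le_trans num.
(* An infinite denominator would make the ratio 0, against lambda > 0; a finite one is at least 2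
   delta and can be cleared. *)
case: (lebesgue2 (annulus delta p.1 p.2)) ratio den => [b| |] //=; last first.
  by rewrite invey mule0 lte_fin => /(lt_trans l0); rewrite ltxx.
rewrite lee_fin => ratio den; have b0 : 0 < b by lra.
move: ratio; rewrite inver gt_eqF// lte_pdivlMr// -EFinM; apply: le_lt_trans.
by rewrite lee_fin; nra.
Qed.

Lemma poweR_cube_sixth (R : realType) (y : \bar R) : (0 <= y)%E ->
  ((y * y * y) `^ 6^-1 = y `^ 2^-1)%E.
Proof.
move=> y0; rewrite !poweRM// ?mule_ge0//.
have n6 : 6^-1 + 6^-1 != 0 :> R by apply/eqP; lra.
have n2 : 6^-1 + 6^-1 + 6^-1 != 0 :> R by apply/eqP; lra.
rewrite -poweRD ?add_neq0_poweRD_def// -poweRD ?add_neq0_poweRD_def//.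
by congr poweR; lra.
Qed.

Theorem mainTheorem3 (R : realType) (eta : R) (eta_gt0 : 0 < eta) :
  exists C : R, forall (delta : R) (E : set (R * R)) (lambda : R),
    0 < delta < 2^-1 ->
    lebesgue_measurable2 E ->
    E `<=` `[0, 1] `*` `[0, 1] ->
    0 < lambda ->
    (lambda%:E * lebesgue3 (richset delta lambda E) `^ 6^-1
       <= (C * delta `^ (- eta))%:E * lebesgue2 E `^ 2^-1)%E.
Proof.
have [K K0 KE] : exists2 K : R, 0 <= K & K = 40 * 960 ^+ 4.
  exists (40 * 960 ^+ 4); last by [].
  apply: mulr_ge0; first exact: ler0n.
  by apply: exprn_ge0; exact: ler0n.
(* The sixth root of the constant in [rich_borel_measure_le], since the cubic estimate is raised to
   the power 1/6 at the end. *)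
exists (K `^ 6^-1) => delta E lambda /andP[d0 d1] _ _ l0.
set mu2 := (@lebesgue_measure R \x @lebesgue_measure R)%E.
set mu3 := (@lebesgue_measure R \x @lebesgue_measure R \x @lebesgue_measure R)%E.
have [G [mG EG Gle]] := measurable_hull mu2 E.
have E0 : (0 <= lebesgue2 E)%E by exact: mu_ext_ge0.
have F0 : (0 <= lebesgue3 (richset delta lambda E))%E by exact: mu_ext_ge0.
have cubes : ((lambda ^+ 6)%:E * lebesgue3 (richset delta lambda E) <=
    K%:E * (lebesgue2 E * lebesgue2 E * lebesgue2 E))%E.
  have d12 : delta < 1 / 2 by lra.
  apply: (@le_trans _ _ ((lambda ^+ 6)%:E * mu3 (rich_borel delta lambda G))%E).
    apply: lee_wpmul2l; first by rewrite lee_fin exprn_ge0// ltW.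
    apply: (@le_trans _ _ (lebesgue3 (rich_borel delta lambda G))).
      by apply: le_mu_ext; exact: richset_sub_borel.
    by rewrite [leLHS](measurable_mu_extE mu3 (measurable_rich_borel _ _ mG)).
  apply: (le_trans (rich_borel_measure_le d0 d12 l0 mG)); rewrite -KE.
  by apply: lee_wpmul2l => //; do ! apply: lee_pmul => //; exact: mule_ge0.
(* As delta < 1, the factor delta^(-eta) only enlarges the right-hand side. *)
have dle : 1 <= delta `^ (- eta).
  rewrite powRN invf_ge1 ?powR_gt0// -(powRr0 delta).
  by apply: ger_powR; [lra|exact: ltW].
have -> : (lambda%:E * lebesgue3 (richset delta lambda E) `^ 6^-1 =
    ((lambda ^+ 6)%:E * lebesgue3 (richset delta lambda E)) `^ 6^-1)%E.
  rewrite poweRM// ?lee_fin ?exprn_ge0 ?ltW// poweR_EFin; congr (_%:E * _)%E.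
  by rewrite -powR_mulrn ?ltW// -powRrM mulfV// powRr1// ltW.
apply: (@le_trans _ _ ((K%:E * (lebesgue2 E * lebesgue2 E * lebesgue2 E)) `^ 6^-1)%E).
  apply: gt0_ler_poweR => //; rewrite ?in_itv/= ?leey ?andbT ?mule_ge0//.
  by rewrite lee_fin exprn_ge0// ltW.
rewrite poweRM ?lee_fin ?mule_ge0// poweR_EFin poweR_cube_sixth//.
apply: lee_wpmul2r; first exact: poweR_ge0.
by rewrite lee_fin ler_peMr// powR_ge0.
Qed.
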